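(* Let $A\in M_k\otimes M_k$ be an SPC matrix with Hermitian Schmidt decomposition $A=\sum_{i=1}^n\lambda_i\gamma_i\otimes\gamma_i$, where $\lambda_1=\dots=\lambda_s>\lambda_{s+1}\geq\dots\geq\lambda_n>0$. Let $D=\sum_{i=1}^s\gamma_i\otimes\gamma_i$. (a) There exists a unique (up to the order of the summands) Hermitian Schmidt decomposition $D=\sum_{i=1}^s\gamma_i'\otimes\gamma_i'$ such that $\gamma_i'$ is positive semidefinite for $1\leq i\leq s$. (b) For $1\leq i\leq s$ let $V_i\in M_k$ be the Hermitian projection onto the image $\Im(\gamma_i')$, and let $V_{s+1}\in M_k$ be the Hermitian projection onto $(\Im(\gamma_1')\oplus\dots\oplus\Im(\gamma_s'))^{\perp}$. Then $$A=\sum_{i=1}^{s+1}(V_i\otimes V_i)A(V_i\otimes V_i),$$ and $(V_i\otimes V_i)A(V_i\otimes V_i)$ is SPC for $1\leq i\leq s+1$.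
   Context: $M_k$ denotes the complex $k\times k$ matrices, and $M_k\otimes M_m$ is identified with $M_{km}$ via the Kronecker product. $M_k$ carries the inner product $\langle C,D\rangle=\mathrm{tr}(CD^* )$. $\Im(X)$ denotes the image (column space) of a matrix $X$. A Hermitian projection is an orthogonal projection matrix. A Hermitian Schmidt decomposition of a Hermitian $A\in M_k\otimes M_m$ is an expression $A=\sum_{i=1}^n\lambda_i\gamma_i\otimes\delta_i$ with real $\lambda_i>0$, where $\{\gamma_1,\dots,\gamma_n\}\subset M_k$ and $\{\delta_1,\dots,\delta_n\}\subset M_m$ are orthonormal sets of Hermitian matrices. A positive semidefinite Hermitian matrix $A\in M_k\otimes M_k$ is SPC (symmetric with positive coefficients) if it has a Hermitian Schmidt decomposition of the form $A=\sum_{i=1}^n\lambda_i\gamma_i\otimes\gamma_i$ with all $\lambda_i>0$. The zero matrix is regarded as SPC (with the empty decomposition). *)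

(* Defs.v *)
From HB Require Import structures.
From mathcomp Require Import all_boot all_order all_fingroup all_algebra.
From mathcomp Require mxtens.

Set Implicit Arguments.
Unset Strict Implicit.
Unset Printing Implicit Defensive.

Import Order.TTheory GRing.Theory Num.Theory.
Local Open Scope ring_scope.
Local Open Scope sesquilinear_scope.

(* mxtens is not imported: its [A ^t k] clashes with the adjoint [A ^t*]. *)
Notation "A *t B" := (mxtens.tensmx A B)
  (at level 40, left associativity, format "A  *t  B") : ring_scope.

Definition hs_inner (C : numClosedFieldType) (k : nat) (A B : 'M[C]_k) : C :=
  \tr (A *m B ^t*).

Definition orthonormal_family (C : numClosedFieldType) (k n : nat)
    (g : 'I_n -> 'M[C]_k) : Prop :=
  forall i j, hs_inner (g i) (g j) = (i == j)%:R.

(* The order of a numClosedFieldType is partial: [0 <= z] says that z is real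
   and nonnegative, and [0 < z] that z is real and positive. *)
Definition psdmx (C : numClosedFieldType) (k : nat) (A : 'M[C]_k) : Prop :=
  A \is hermsymmx /\ forall v : 'cV[C]_k, 0 <= (v ^t* *m A *m v) 0 0.

Definition hermitian_schmidt (C : numClosedFieldType) (k m n : nat)
    (A : 'M[C]_(k * m)) (lam : 'I_n -> C)
    (g : 'I_n -> 'M[C]_k) (d : 'I_n -> 'M[C]_m) : Prop :=
  [/\ forall i, 0 < lam i,
      forall i, g i \is hermsymmx /\ d i \is hermsymmx,
      orthonormal_family g,
      orthonormal_family d
    & A = \sum_(i < n) lam i *: (g i *t d i)].

Definition is_SPC (C : numClosedFieldType) (k : nat) (A : 'M[C]_(k * k)) : Prop :=
  psdmx A /\
  exists (n : nat) (lam : 'I_n -> C) (g : 'I_n -> 'M[C]_k),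
    hermitian_schmidt A lam g g.

(* MathComp subspaces are spaces of row vectors and matrices act on the right.
   The column space of X is the set of transposes of the rows in the row space
   of X^T, and transposition preserves orthogonality, so a column projection is
   the transpose of the corresponding row projection. *)
Definition colspace (C : numClosedFieldType) (k : nat) (X : 'M[C]_k) : 'M[C]_k :=
  X^T.

Definition orthocompl (C : numClosedFieldType) (k : nat) (W : 'M[C]_k) :
    'M[C]_k :=
  orthomx Num.conj 1%:M W.

Definition herm_proj (C : numClosedFieldType) (k : nat) (W : 'M[C]_k) : 'M[C]_k :=
  (proj_ortho W)^T.

(* Index [lift ord_max i] carries the projection onto the image of [g i];
   [ord_max] carries the projection onto the orthogonal complement of the sum
   of all these images. *)
Definition image_projs (C : numClosedFieldType) (k s : nat) (g : 'I_s -> 'M[C]_k)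
    (j : 'I_s.+1) : 'M[C]_k :=
  if unlift ord_max j is Some i then herm_proj (colspace (g i))
  else herm_proj (orthocompl (\sum_(i < s) colspace (g i))%MS).

Definition compress (C : numClosedFieldType) (k : nat) (V : 'M[C]_k)
    (A : 'M[C]_(k * k)) : 'M[C]_(k * k) :=
  (V *t V) *m A *m (V *t V).

(* Main.v *)
(* The map [T X = sum_i lam_i tr (g_i X) g_i] satisfies
   [tr (A (X (x) Y)) = tr (T X * Y)], so it is positive because [A] is, and it
   is self-adjoint and positive semidefinite because [A] is SPC. Let [W] be its
   top eigenspace among Hermitian matrices. Positivity and the variational
   characterization of [W] show that [W] contains the positive part of each of
   its elements. If [V] is the support projection of a positive semidefinite
   [X] in [W], then [tr (A (X (x) (1 - V))) = l tr (X (1 - V)) = 0] forces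
   [A (V (x) (1 - V)) = 0], and then all [g_i] commute with [V]. Hence [W] and
   [A] split along [V], and repeated splitting ends with pieces of [W] of
   dimension at most one, which gives the orthonormal positive semidefinite
   basis. Two such bases are related by an orthogonal matrix with nonnegative
   entries, that is, a permutation matrix. *)

Require Import Defs.
From mathcomp Require Import all_boot all_order all_fingroup all_algebra.
From mathcomp Require Import ring.
From mathcomp Require Import boolp reals complex.

Set Implicit Arguments.
Unset Strict Implicit.
Unset Printing Implicit Defensive.

Import Order.TTheory GRing.Theory Num.Theory.
Local Open Scope ring_scope.
Local Open Scope sesquilinear_scope.

(** * Adjoints, tensor products and positive semidefinite matrices *)

Section AdjointAndTrace.
Variable C : numClosedFieldType.

Lemma hermsymmxP (k : nat) (A : 'M[C]_k) :
  reflect (A^t* = A) (A \is hermsymmx).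
Proof.
by apply: (iffP (is_hermitianmxP _ _ _)); rewrite expr0 scale1r.
Qed.

Lemma adjmxM (m n p : nat) (A : 'M[C]_(m, n)) (B : 'M[C]_(n, p)) :
  (A *m B)^t* = B^t* *m A^t*.
Proof. by rewrite trmx_mul map_mxM. Qed.

Lemma adjmxD (m n : nat) (A B : 'M[C]_(m, n)) : (A + B)^t* = A^t* + B^t*.
Proof. by rewrite linearD map_mxD. Qed.

Lemma adjmxN (m n : nat) (A : 'M[C]_(m, n)) : (- A)^t* = - A^t*.
Proof. by rewrite linearN map_mxN. Qed.

Lemma adjmxZ (m n : nat) (a : C) (A : 'M[C]_(m, n)) : (a *: A)^t* = a^* *: A^t*.
Proof. by rewrite linearZ map_mxZ. Qed.

Lemma adjmx1 (n : nat) : (1%:M : 'M[C]_n)^t* = 1%:M.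
Proof. by rewrite trmx1 map_mx1. Qed.

Lemma adjmx_sum (I : Type) (r : seq I) (P : pred I) (m n : nat)
    (F : I -> 'M[C]_(m, n)) :
  (\sum_(i <- r | P i) F i)^t* = \sum_(i <- r | P i) (F i)^t*.
Proof. by rewrite raddf_sum map_mx_sum. Qed.

Lemma mxtrace_adj (n : nat) (A : 'M[C]_n) : \tr (A^t*) = (\tr A)^*.
Proof.
by rewrite -map_trmx mxtrace_tr raddf_sum; apply: eq_bigr => i _; rewrite mxE.
Qed.

Lemma mulmx_tr_ge0 (m n : nat) (A : 'M[C]_(m, n)) : 0 <= \tr (A *m A^t*).
Proof.
apply: sumr_ge0 => i _; rewrite mxE; apply: sumr_ge0 => j _.
by rewrite !mxE -normCK exprn_ge0.
Qed.

Lemma mulmx_tr_eq0 (m n : nat) (A : 'M[C]_(m, n)) :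
  \tr (A *m A^t*) = 0 -> A = 0.
Proof.
move=> A0; apply/matrixP => i j; rewrite mxE.
have pos i' j' : 0 <= A i' j' * A^t* j' i' by rewrite !mxE -normCK exprn_ge0.
have pos' i' : 0 <= (A *m A^t*) i' i' by rewrite mxE sumr_ge0.
move: A0; rewrite /mxtrace => /eqP; rewrite psumr_eq0 // => /allP/(_ i).
rewrite mem_index_enum => /(_ isT) /eqP; rewrite mxE => /eqP.
rewrite psumr_eq0 // => /allP/(_ j); rewrite mem_index_enum => /(_ isT).
by rewrite !mxE -normCK expf_eq0 /= normr_eq0 => /eqP.
Qed.

Lemma mxtrace_mul_inj (n : nat) (A B : 'M[C]_n) :
  (forall Y, \tr (A *m Y) = \tr (B *m Y)) -> A = B.
Proof.
move=> AB; apply/eqP; rewrite -subr_eq0; apply/eqP/mulmx_tr_eq0.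
by rewrite mulmxBl linearB /= AB subrr.
Qed.

Lemma mxtrace_mul_real (n : nat) (X Y : 'M[C]_n) :
  X^t* = X -> Y^t* = Y -> \tr (X *m Y) \is Num.real.
Proof.
by move=> hX hY; apply/CrealP; rewrite -mxtrace_adj adjmxM hX hY mxtrace_mulC.
Qed.

Lemma herm_sqr_eq0 (n : nat) (X : 'M[C]_n) :
  X^t* = X -> \tr (X *m X) = 0 -> X = 0.
Proof. by move=> hX X0; apply: mulmx_tr_eq0; rewrite hX. Qed.

Lemma herm_absorb (n : nat) (X Y : 'M[C]_n) :
  X^t* = X -> Y^t* = Y -> X *m Y = Y -> Y *m X = Y.
Proof. by move=> hX hY XY; rewrite -[RHS]hY -[in RHS]XY adjmxM hX hY. Qed.

Lemma mulmx_adj_eq0 (n : nat) (X Y : 'M[C]_n) :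
  X^t* = X -> Y^t* = Y -> X *m Y = 0 -> Y *m X = 0.
Proof.
by move=> hX hY XY; rewrite -[LHS]trmxCK adjmxM hX hY XY trmx0 map_mx0.
Qed.

End AdjointAndTrace.

(** * Bilinearity, adjoints and traces of Kronecker products *)

Section Tensor.
Variable C : numClosedFieldType.

Lemma tensmxDl (m n p q : nat) (A B : 'M[C]_(m, n)) (D : 'M[C]_(p, q)) :
  (A + B) *t D = A *t D + B *t D.
Proof. by apply/matrixP => i j; rewrite !mxE mulrDl. Qed.

Lemma tensmxDr (m n p q : nat) (D : 'M[C]_(m, n)) (A B : 'M[C]_(p, q)) :
  D *t (A + B) = D *t A + D *t B.
Proof. by apply/matrixP => i j; rewrite !mxE mulrDr. Qed.

Lemma tensmxZl (m n p q : nat) (a : C) (A : 'M[C]_(m, n)) (D : 'M[C]_(p, q)) :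
  (a *: A) *t D = a *: (A *t D).
Proof. by apply/matrixP => i j; rewrite !mxE mulrA. Qed.

Lemma tensmxZr (m n p q : nat) (a : C) (D : 'M[C]_(m, n)) (A : 'M[C]_(p, q)) :
  D *t (a *: A) = a *: (D *t A).
Proof. by apply/matrixP => i j; rewrite !mxE mulrCA. Qed.

Lemma tensmx_suml (I : Type) (r : seq I) (P : pred I) (m n p q : nat)
    (F : I -> 'M[C]_(m, n)) (D : 'M[C]_(p, q)) :
  (\sum_(i <- r | P i) F i) *t D = \sum_(i <- r | P i) F i *t D.
Proof.
elim/big_rec2: _ => [|i X Y _ <-]; first by rewrite mxtens.tens0mx.
by rewrite tensmxDl.
Qed.

Lemma tensmx_sumr (I : Type) (r : seq I) (P : pred I) (m n p q : nat)
    (D : 'M[C]_(m, n)) (F : I -> 'M[C]_(p, q)) :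
  D *t (\sum_(i <- r | P i) F i) = \sum_(i <- r | P i) D *t F i.
Proof.
elim/big_rec2: _ => [|i X Y _ <-]; first by rewrite mxtens.tensmx0.
by rewrite tensmxDr.
Qed.

Lemma tensmx11 (m n : nat) : (1%:M : 'M[C]_m) *t (1%:M : 'M[C]_n) = 1%:M.
Proof.
apply/matrixP => i j; rewrite !mxE.
rewrite -[X in _ = (X == _)%:R]mxtens.mxtens_unindexK.
rewrite -[X in _ = (_ == X)%:R]mxtens.mxtens_unindexK.
rewrite (can_eq (@mxtens.mxtens_indexK m n)) -pair_eqE /=.
by case: eqP; case: eqP; rewrite ?mulr0 ?mul0r ?mulr1.
Qed.

Lemma tensmx_adj (m n p q : nat) (A : 'M[C]_(m, n)) (B : 'M[C]_(p, q)) :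
  (A *t B)^t* = A^t* *t B^t*.
Proof. by rewrite mxtens.trmx_tens mxtens.map_mxT. Qed.

Lemma mxtrace_tens (m n : nat) (A : 'M[C]_m) (B : 'M[C]_n) :
  \tr (A *t B) = \tr A * \tr B.
Proof.
by rewrite /mxtrace mxtens.mulr_sum; apply: eq_bigr => i _; rewrite mxE.
Qed.

End Tensor.

(** * Factorizations and traces of positive semidefinite matrices *)

Section PositiveSemidefinite.
Variable C : numClosedFieldType.

Lemma psdmx_mul_adj (k m : nat) (R : 'M[C]_(k, m)) : psdmx (R *m R^t*).
Proof.
split=> [|v]; first by apply/hermsymmxP; rewrite adjmxM trmxCK.
have -> : v^t* *m (R *m R^t*) *m v = (v^t* *m R) *m (v^t* *m R)^t*.
  by rewrite adjmxM trmxCK !mulmxA.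
by rewrite -trace_mx11 mulmx_tr_ge0.
Qed.

Lemma unitary_diag_factor (k : nat) (U : 'M[C]_k) (e : 'rV[C]_k) :
  (forall i, 0 <= e 0 i) ->
  U^t* *m diag_mx e *m U = U^t* *m diag_mx (map_mx sqrtC e) *m
    (U^t* *m diag_mx (map_mx sqrtC e))^t*.
Proof.
move=> e0; rewrite adjmxM trmxCK tr_diag_mx map_diag_mx mulmxA.
rewrite -[in RHS](mulmxA (U^t*)) mulmx_diag.
congr (_ *m diag_mx _ *m _); apply/rowP => i; rewrite !mxE.
by rewrite /= geC0_conj ?sqrtC_ge0 // -expr2 sqrtCK.
Qed.

Lemma psdmx_factor (k : nat) (A : 'M[C]_k) :
  psdmx A -> exists R : 'M[C]_k, A = R *m R^t*.
Proof.
move=> [hA pA]; have /hermitian_normalmx/orthomx_spectralP := hA.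
set U := spectralmx A; set d := spectral_diag A => EA.
have uU : U \is unitarymx := spectral_unitarymx A.
have d_ge0 i : 0 <= d 0 i.
  have := pA (U^t* *m delta_mx i 0); rewrite adjmxM trmxCK EA invmx_unitary //.
  rewrite !mulmxA !mulmxtVK // trmx_delta map_delta_mx.
  by rewrite -colE -rowE !mxE eqxx mulr1n.
exists (U^t* *m diag_mx (map_mx sqrtC d)).
by rewrite {1}EA invmx_unitary // unitary_diag_factor.
Qed.

Lemma psdmx_herm (k : nat) (A : 'M[C]_k) : psdmx A -> A^t* = A.
Proof. by case=> /hermsymmxP. Qed.

Lemma herm_sqr_gt0 (k : nat) (X : 'M[C]_k) :
  X^t* = X -> X != 0 -> 0 < \tr (X *m X).
Proof.
move=> hX; apply: contra_neqT; rewrite lt_neqAle negb_and negbK.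
have := mulmx_tr_ge0 X; rewrite hX => -> /= /orP[/eqP /esym|] //.
exact: herm_sqr_eq0.
Qed.

Lemma herm_normalize (k : nat) (X : 'M[C]_k) : X^t* = X -> X != 0 ->
  exists2 r : C, 0 <= r & \tr ((r *: X) *m (r *: X)) = 1.
Proof.
move=> hX X0; have t_gt0 := herm_sqr_gt0 hX X0; set t := \tr _ in t_gt0.
exists (sqrtC t)^-1; first by rewrite invr_ge0 sqrtC_ge0 ltW.
rewrite -scalemxAl -scalemxAr !linearZ /= -/t mulrA -invfM -expr2 sqrtCK.
by rewrite mulVf // gt_eqF.
Qed.

Lemma psdmx_conj (k m : nat) (A : 'M[C]_k) (B : 'M[C]_(m, k)) :
  psdmx A -> psdmx (B *m A *m B^t*).
Proof.
move=> /psdmx_factor[R ->]; have := psdmx_mul_adj (B *m R).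
by rewrite adjmxM !mulmxA.
Qed.

Lemma psdmx_tens (k m : nat) (A : 'M[C]_k) (B : 'M[C]_m) :
  psdmx A -> psdmx B -> psdmx (A *t B).
Proof.
move=> /psdmx_factor[R ->] /psdmx_factor[S ->].
by rewrite -mxtens.tensmx_mul -tensmx_adj; apply: psdmx_mul_adj.
Qed.

Lemma psdmxZ (k : nat) (a : C) (A : 'M[C]_k) :
  0 <= a -> psdmx A -> psdmx (a *: A).
Proof.
move=> a0 [/hermsymmxP hA pA]; split=> [|v].
  by apply/hermsymmxP; rewrite adjmxZ hA /= geC0_conj.
by rewrite -scalemxAr -scalemxAl mxE mulr_ge0.
Qed.

Lemma psdmx_tr_ge0 (k : nat) (A B : 'M[C]_k) :
  psdmx A -> psdmx B -> 0 <= \tr (A *m B).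
Proof.
move=> /psdmx_factor[R ->] /psdmx_factor[S ->].
rewrite -mulmxA mxtrace_mulC.
have -> : R^t* *m (S *m S^t*) *m R = (R^t* *m S) *m (R^t* *m S)^t*.
  by rewrite adjmxM trmxCK !mulmxA.
exact: mulmx_tr_ge0.
Qed.

(** With [A = R R^*] and [B = S S^*] the trace is the squared norm of [R^* S], a factor of [A B]. *)
Lemma psdmx_tr_eq0 (k : nat) (A B : 'M[C]_k) :
  psdmx A -> psdmx B -> \tr (A *m B) = 0 -> A *m B = 0.
Proof.
move=> /psdmx_factor[R ->] /psdmx_factor[S ->].
rewrite -mulmxA mxtrace_mulC.
have -> : R^t* *m (S *m S^t*) *m R = (R^t* *m S) *m (R^t* *m S)^t*.
  by rewrite adjmxM trmxCK !mulmxA.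
move=> /mulmx_tr_eq0 RS0; rewrite !mulmxA -[R *m R^t* *m S]mulmxA RS0.
by rewrite mulmx0 mul0mx.
Qed.

(** Functional calculus on the spectral decomposition. The factors [M] and [M'] record that both
    parts have image inside that of [X], so a projection fixing [X] fixes them too. *)
Lemma herm_pos_neg (k : nat) (X : 'M[C]_k) : X^t* = X ->
  exists P N : 'M[C]_k, [/\ psdmx P, psdmx N, X = P - N, P *m N = 0 &
    exists M M', P = X *m M /\ N = X *m M'].
Proof.
move=> /hermsymmxP hX; have /hermitian_normalmx/orthomx_spectralP := hX.
have /mxOverP d_real := hermitian_spectral_diag_real hX.
set U := spectralmx X; set d := spectral_diag X in d_real * => EX.
have uU : U \is unitarymx := spectral_unitarymx X.
move: EX; rewrite invmx_unitary // => EX.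
pose f (e : 'rV[C]_k) := U^t* *m diag_mx e *m U.
have fM e e' : f e *m f e' = f (\row_i (e 0 i * e' 0 i)).
  rewrite /f !mulmxA mulmxtVK //.
  by rewrite -(mulmxA (U^t*)) mulmx_diag.
have f_psd (e : 'rV[C]_k) : (forall i, 0 <= e 0 i) -> psdmx (f e).
  by move=> e0; rewrite /f unitary_diag_factor //; apply: psdmx_mul_adj.
have EXf : X = f d by rewrite /f.
exists (f (\row_i (if 0 <= d 0 i then d 0 i else 0))).
exists (f (\row_i (if 0 <= d 0 i then 0 else - d 0 i))); split.
- by apply: f_psd => i; rewrite mxE; case: ifP.
- apply: f_psd => i; rewrite mxE; case: ifP => // d0.
  rewrite oppr_ge0; have := d_real 0 i.
  by rewrite realE d0.
- rewrite {1}EXf /f -mulmxBl -mulmxBr; congr (_ *m _ *m _).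
  rewrite -linearB /=; congr diag_mx; apply/rowP => i; rewrite !mxE.
  by case: ifP; rewrite ?subr0 ?sub0r ?opprK.
- rewrite fM; set e := \row_i _; have -> : e = 0.
    by apply/rowP => i; rewrite !mxE; case: ifP; rewrite ?mul0r ?mulr0.
  by rewrite /f linear0 mulmx0 mul0mx.
- exists (f (\row_i (if 0 <= d 0 i then 1 else 0))).
  exists (f (\row_i (if 0 <= d 0 i then 0 else -1))).
  rewrite {1 2}EXf !fM; split; congr f; apply/rowP => i; rewrite !mxE.
    by case: ifP; rewrite ?mulr1 ?mulr0.
  by case: ifP; rewrite ?mulr0 ?mulrN1.
Qed.

End PositiveSemidefinite.

(** * Orthogonal projections and supports *)

Section Projections.
Variable C : numClosedFieldType.

Definition herm_idem (k : nat) (V : 'M[C]_k) := V^t* = V /\ V *m V = V.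

(** The orthogonal projection onto the column space of [X]: [V X = X] gives one inclusion of images,
    [V = X M] the other. *)
Definition support_proj (k : nat) (X V : 'M[C]_k) :=
  [/\ herm_idem V, V *m X = X & exists M, V = X *m M].

Lemma proj_ortho_unique (k m : nat) (U : 'M[C]_(m, k)) (V : 'M[C]_k) :
  (V <= U)%MS -> (1%:M - V) *m U^t* = 0 -> proj_ortho U = V.
Proof.
move=> VU U0; rewrite -[LHS]mul1mx -[1%:M in LHS](subrK V) mulmxDl.
by rewrite proj_ortho_0 ?proj_ortho_id ?add0r //; apply/orthomx1P.
Qed.

Lemma adj_eq_of_mul_adj (k : nat) (P : 'M[C]_k) : P *m P^t* = P^t* -> P = P^t*.
Proof. by move=> EP; rewrite -[LHS]trmxCK -{1}EP adjmxM trmxCK. Qed.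

(** Let [P] be the projection. The rows of [1 - P] are orthogonal to the row space of [U], which
    contains the rows of [P]. Hence [P P^t* = P^t*], and the left side is self-adjoint. *)
Lemma proj_ortho_herm_idem (k m : nat) (U : 'M[C]_(m, k)) :
  herm_idem (proj_ortho U).
Proof.
split; last exact: proj_ortho_proj.
have /submxP[M EM] : (proj_ortho U <= U)%MS by rewrite proj_orthoE.
have := proj_ortho_compl_sub U (1%:M : 'M[C]_k).
move=> /orthomx1P; rewrite mul1mx => U0.
apply: esym; apply: adj_eq_of_mul_adj; apply/eqP.
rewrite eq_sym -subr_eq0 -[X in X - _]mul1mx -mulmxBl.
by rewrite [X in _ *m X^t*]EM adjmxM mulmxA U0 mul0mx.
Qed.

Lemma herm_proj_herm_idem (k : nat) (W : 'M[C]_k) : herm_idem (herm_proj W).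
Proof.
have [hP PP] := proj_ortho_herm_idem W; split.
  by rewrite /herm_proj -map_trmx hP.
by rewrite /herm_proj -trmx_mul PP.
Qed.

Lemma herm_proj_support (k : nat) (X : 'M[C]_k) :
  support_proj X (herm_proj (colspace X)).
Proof.
split; first exact: herm_proj_herm_idem.
  by rewrite -[X in RHS]trmxK -(proj_ortho_id (submx_refl X^T)) trmx_mul trmxK.
have /submxP[M EM] : (proj_ortho X^T <= X^T)%MS by rewrite proj_orthoE.
by exists M^T; rewrite /herm_proj EM trmx_mul trmxK.
Qed.

Lemma herm_idemC (k : nat) (V : 'M[C]_k) : herm_idem V -> herm_idem (1%:M - V).
Proof.
move=> [hV VV]; split; first by rewrite adjmxD adjmxN adjmx1 hV.
by rewrite mulmxBl mul1mx mulmxBr mulmx1 VV subrr subr0.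
Qed.

Lemma herm_idem_sub (k : nat) (P V : 'M[C]_k) :
  herm_idem P -> herm_idem V -> P *m V = V -> herm_idem (P - V).
Proof.
move=> [hP PP] [hV VV] PV.
have VP := herm_absorb hP hV PV.
split; first by rewrite adjmxD adjmxN hP hV.
by rewrite mulmxBl !mulmxBr PP PV VP VV subrr subr0.
Qed.

Lemma herm_idem_rank_lt (k : nat) (P V : 'M[C]_k) :
  herm_idem P -> herm_idem V -> P *m V = V -> V != P -> (\rank V < \rank P)%N.
Proof.
move=> [hP PP] [hV VV] PV; apply: contraNltn => rPV.
have VP := herm_absorb hP hV PV.
have leVP : (V <= P)%MS by rewrite -VP submxMl.
have /submxP[M EM] : (P <= V)%MS.
  by rewrite -(mxrank_leqif_sup leVP) eqn_leq rPV mxrankS.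
by rewrite -PV {1}EM -mulmxA VV -EM.
Qed.

Lemma psdmx_herm_idem (k : nat) (V : 'M[C]_k) : herm_idem V -> psdmx V.
Proof. by move=> [hV VV]; have := psdmx_mul_adj V; rewrite hV VV. Qed.

End Projections.

(** * The map induced by a Schmidt decomposition and its top eigenspace *)

Section SchmidtOperator.
Variables (C : numClosedFieldType) (k n : nat) (A : 'M[C]_(k * k)).
Variables (lam : 'I_n -> C) (g : 'I_n -> 'M[C]_k).

(** The map [T], defined for any family: with all weights one it also serves as the frame operator
    of a family that need not be orthonormal. *)
Definition schmidt_op (X : 'M[C]_k) : 'M[C]_k :=
  \sum_i (lam i * \tr (g i *m X)) *: g i.

Lemma schmidt_opB (X Y : 'M[C]_k) :
  schmidt_op (X - Y) = schmidt_op X - schmidt_op Y.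
Proof.
rewrite /schmidt_op -sumrB; apply: eq_bigr => i _.
by rewrite mulmxBr linearB /= mulrBr scalerBl.
Qed.

Lemma schmidt_opZ (a : C) (X : 'M[C]_k) :
  schmidt_op (a *: X) = a *: schmidt_op X.
Proof.
rewrite /schmidt_op scaler_sumr; apply: eq_bigr => i _.
by rewrite -scalemxAr linearZ /= mulrCA scalerA.
Qed.

Lemma schmidt_op_sum (I : finType) (F : I -> 'M[C]_k) :
  schmidt_op (\sum_j F j) = \sum_j schmidt_op (F j).
Proof.
rewrite /schmidt_op exchange_big; apply: eq_bigr => i _ /=.
by rewrite mulmx_sumr raddf_sum mulr_sumr scaler_suml.
Qed.

Lemma schmidt_op_trE (X Y : 'M[C]_k) :
  \tr (schmidt_op X *m Y) = \sum_i lam i * \tr (g i *m X) * \tr (g i *m Y).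
Proof.
rewrite mulmx_suml raddf_sum; apply: eq_bigr => i _.
by rewrite -scalemxAl /= linearZ.
Qed.

Lemma schmidt_op_sym (X Y : 'M[C]_k) :
  \tr (schmidt_op X *m Y) = \tr (schmidt_op Y *m X).
Proof. by rewrite !schmidt_op_trE; apply: eq_bigr => i _; rewrite mulrAC. Qed.

Hypothesis lam_gt0 : forall i, 0 < lam i.
Hypothesis g_herm : forall i, (g i)^t* = g i.
Hypothesis g_on : forall i j, \tr (g i *m g j) = (i == j)%:R.
Hypothesis A_def : A = \sum_i lam i *: (g i *t g i).
Hypothesis A_psd : psdmx A.

Lemma schmidt_op_tens (X Y : 'M[C]_k) :
  \tr (A *m (X *t Y)) = \tr (schmidt_op X *m Y).
Proof.
rewrite schmidt_op_trE A_def mulmx_suml raddf_sum; apply: eq_bigr => i _ /=.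
by rewrite -scalemxAl linearZ /= mxtens.tensmx_mul mxtrace_tens mulrA.
Qed.

Lemma schmidt_op_herm (X : 'M[C]_k) :
  X^t* = X -> (schmidt_op X)^t* = schmidt_op X.
Proof.
move=> hX; rewrite adjmx_sum; apply: eq_bigr => i _.
rewrite adjmxZ g_herm rmorphM /= geC0_conj ?ltW //.
by rewrite conj_Creal // mxtrace_mul_real.
Qed.

Lemma schmidt_op_gen (i : 'I_n) : schmidt_op (g i) = lam i *: g i.
Proof.
rewrite /schmidt_op (bigD1 i) //= g_on eqxx mulr1 big1 ?addr0 // => j ji.
by rewrite g_on (negPf ji) mulr0 scale0r.
Qed.

Section TopEigenspace.
Variable l : C.
Hypothesis l_gt0 : 0 < l.
Hypothesis lam_le : forall i, lam i <= l.

(** Restricting to Hermitian matrices gives a real vector space whose elements have positive and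
    negative parts. *)
Definition top_eigen (X : 'M[C]_k) := X^t* = X /\ schmidt_op X = l *: X.

Lemma top_eigen_sub (X Y : 'M[C]_k) :
  top_eigen X -> top_eigen Y -> top_eigen (X - Y).
Proof.
move=> [hX TX] [hY TY]; split; first by rewrite adjmxD adjmxN hX hY.
by rewrite schmidt_opB TX TY scalerBr.
Qed.

Lemma top_eigen_scale (a : C) (X : 'M[C]_k) :
  a \is Num.real -> top_eigen X -> top_eigen (a *: X).
Proof.
move=> /CrealP ha [hX TX]; split; first by rewrite adjmxZ hX ha.
by rewrite schmidt_opZ TX !scalerA mulrC.
Qed.

(* The quadratic form of the induced map is at most [l], with equality only on
   the eigenspace of [l]: [|l X - T X|^2 <= l (l |X|^2 - <T X, X>)]. *)
Lemma top_eigen_form (X : 'M[C]_k) : X^t* = X ->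
  l * \tr (X *m X) <= \tr (schmidt_op X *m X) -> top_eigen X.
Proof.
move=> hX lX; split=> //; set T := schmidt_op X in lX *.
have hT : T^t* = T by apply: schmidt_op_herm.
(* In the real coordinates [c_i = tr (g_i X)] this compares [lam_i^2 c_i^2] with [l lam_i c_i^2]
   term by term. *)
have TT : \tr (T *m T) <= l * \tr (T *m X).
  rewrite {1 3}/T !schmidt_op_trE mulr_sumr; apply: ler_sum => i _.
  have -> : \tr (g i *m T) = lam i * \tr (g i *m X).
    by rewrite mxtrace_mulC schmidt_op_sym schmidt_op_gen -scalemxAl linearZ.
  rewrite mulrCA ler_wpM2r // -mulrA mulr_ge0 ?(ltW (lam_gt0 _)) //.
  by rewrite -expr2 real_exprn_even_ge0 // mxtrace_mul_real.
have hlT : (l *: X - T)^t* = l *: X - T.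
  by rewrite adjmxD adjmxN adjmxZ hX hT geC0_conj // ltW.
suff /eqP : \tr ((l *: X - T) *m (l *: X - T)) == 0.
  by move/(herm_sqr_eq0 hlT)/eqP; rewrite subr_eq0 eq_sym => /eqP.
have := mulmx_tr_ge0 (l *: X - T); rewrite hlT => ge0.
apply/eqP/le_anti; rewrite ge0 andbT.
have -> : \tr ((l *: X - T) *m (l *: X - T)) =
    l * (l * \tr (X *m X) - \tr (T *m X)) + (\tr (T *m T) - l * \tr (T *m X)).
  rewrite mulmxBl !mulmxBr !linearB /= -!scalemxAl -!scalemxAr !linearZ /=.
  by rewrite (mxtrace_mulC X T); ring.
by rewrite -[leRHS]addr0 lerD ?subr_le0 // pmulr_rle0 // subr_le0.
Qed.

(** Since [P N = 0], the matrix [P + N] has the same norm as [X], while its quadratic form exceeds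
    that of [X] by [4 tr (A (P (x) N)) >= 0]. As [X] attains the maximum, so does [P + N], and
    [2 P = (P + N) + X]. *)
Lemma top_eigen_pos_part (X P N : 'M[C]_k) : top_eigen X ->
  psdmx P -> psdmx N -> X = P - N -> P *m N = 0 -> top_eigen P /\ top_eigen N.
Proof.
move=> WX pP pN EX PN0; have [hX TX] := WX.
have [hP hN] := (psdmx_herm pP, psdmx_herm pN).
have NP0 := mulmx_adj_eq0 hP hN PN0.
have WPN : top_eigen (P - (- N)).
  apply: top_eigen_form; first by rewrite opprK adjmxD hP hN.
  have -> : \tr ((P - - N) *m (P - - N)) = \tr (X *m X).
    rewrite EX opprK !mulmxDl !mulmxDr !mulNmx !mulmxN PN0 NP0 opprK.
    by rewrite !oppr0 !addr0 !add0r.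
  rewrite -linearZ /= scalemxAl -TX -subr_ge0.
  have -> : \tr (schmidt_op (P - - N) *m (P - - N)) -
      \tr (schmidt_op X *m X) = 4%:R * \tr (schmidt_op P *m N).
    rewrite EX !schmidt_op_trE -sumrB mulr_sumr; apply: eq_bigr => i _.
    by rewrite opprK mulmxDr mulmxBr mxtraceD linearB /=; ring.
  rewrite mulr_ge0 // -schmidt_op_tens psdmx_tr_ge0 //.
  exact: psdmx_tens.
have half x : x = 2%:R^-1 *: (x + x) :> 'M[C]_k.
  by rewrite -mulr2n -scaler_nat scalerA mulVf ?scale1r ?pnatr_eq0.
have WP : top_eigen P.
  rewrite [P]half; apply: top_eigen_scale; first by rewrite realV realn.
  have -> : P + P = (P - - N) - (0 - X).
    by rewrite EX opprK sub0r opprK addrACA subrr addr0.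
  apply: top_eigen_sub => //; apply: top_eigen_sub => //.
  split; rewrite ?trmx0 ?map_mx0 //.
  by rewrite -[0](scale0r 0) schmidt_opZ !scale0r scaler0.
split=> //; have -> : N = P - X by rewrite EX opprB addrC subrK.
exact: top_eigen_sub.
Qed.

(** Dividing the eigenvalue equation by [l] places [X] in the span of the [g i], so whatever
    commutes with all [g i] commutes with [X]. *)
Lemma top_eigen_span (X : 'M[C]_k) : top_eigen X ->
  X = l^-1 *: \sum_i (lam i * \tr (g i *m X)) *: g i.
Proof.
move=> [_ TX]; rewrite -/(schmidt_op X) TX scalerA mulVf ?scale1r //.
by rewrite gt_eqF.
Qed.

(** * Splitting along the support of a positive semidefinite top eigenvector *)

Section Support.
Variables X V : 'M[C]_k.
Hypotheses (X_top : top_eigen X) (X_psd : psdmx X) (V_supp : support_proj X V).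

(** [A] and [X (x) (1 - V)] are positive semidefinite with trace product zero, so their product
    vanishes. The [M] with [V = X M] then replaces [X] by [V]; the other order follows from the
    symmetry of [T]. *)
Lemma support_tens0 :
  A *m (V *t (1%:M - V)) = 0 /\ A *m ((1%:M - V) *t V) = 0.
Proof.
have [hVV VX [M EV]] := V_supp; have [hX TX] := X_top.
have psdV' := psdmx_herm_idem (herm_idemC hVV).
have XV' : X *m (1%:M - V) = 0.
  by have [hV _] := hVV; rewrite mulmxBr mulmx1 (herm_absorb hV hX VX) subrr.
have TXV' : \tr (schmidt_op X *m (1%:M - V)) = 0.
  by rewrite TX -scalemxAl XV' scaler0 linear0.
have V1 : V *t (1%:M - V) = (X *t (1%:M - V)) *m (M *t 1%:M).
  by rewrite mxtens.tensmx_mul mulmx1 -EV.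
have V2 : (1%:M - V) *t V = ((1%:M - V) *t X) *m (1%:M *t M).
  by rewrite mxtens.tensmx_mul mulmx1 -EV.
have A1 : A *m (X *t (1%:M - V)) = 0.
  apply: psdmx_tr_eq0 => //; first exact: psdmx_tens.
  by rewrite schmidt_op_tens.
have A2 : A *m ((1%:M - V) *t X) = 0.
  apply: psdmx_tr_eq0 => //; first exact: psdmx_tens.
  by rewrite schmidt_op_tens schmidt_op_sym.
by rewrite V1 V2 !mulmxA A1 A2 !mul0mx.
Qed.

(* [P = V Z (1 - V)] satisfies [sum_i lam_i |tr (g_i P)|^2 =
   tr (A (P (x) P^* )) = 0], so the off-diagonal blocks of each [g i] vanish. *)
Lemma support_comm (i : 'I_n) : V *m g i = g i *m V.
Proof.
have [hVV _ _] := V_supp; have [A0 _] := support_tens0.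
have [hV _] := hVV; have [hV' _] := herm_idemC hVV.
have block0 j : (1%:M - V) *m g j *m V = 0.
  apply: mxtrace_mul_inj => Z; rewrite mul0mx mxtrace0 -!mulmxA mxtrace_mulC.
  rewrite -!mulmxA; set P := V *m _.
  have : \sum_i lam i * \tr (g i *m P) * \tr (g i *m P^t*) = 0.
    rewrite -schmidt_op_trE -schmidt_op_tens /P !adjmxM hV' hV.
    rewrite -mulmxA -mxtens.tensmx_mul mulmxA.
    by rewrite A0 mul0mx linear0.
  move=> /eqP; rewrite psumr_eq0 => [/allP/(_ j)|i' _].
    rewrite mem_index_enum => /(_ isT); rewrite -mulrA mulf_eq0 gt_eqF //=.
    rewrite -[g j in X in _ * X]g_herm -adjmxM mxtrace_mulC mxtrace_adj.
    rewrite -normCK expf_eq0 normr_eq0 /= => /eqP.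
    by rewrite mxtrace_mulC.
  rewrite -mulrA mulr_ge0 ?(ltW (lam_gt0 _)) //.
  rewrite -[g i' in X in _ * X]g_herm -adjmxM.
  by rewrite mxtrace_adj (mxtrace_mulC P) -normCK exprn_ge0.
(* The right side is self-adjoint, so [g i *m V] equals its adjoint [V *m g i]. *)
have gV : g i *m V = V *m g i *m V.
  by apply/eqP; rewrite -subr_eq0 -!mulmxBl -{1}[g i]mul1mx -mulmxBl block0.
have := congr1 (fun Z : 'M[C]_k => Z^t*) gV.
by rewrite !adjmxM g_herm hV mulmxA -gV.
Qed.

Lemma support_tensl : A *m (V *t V) = A *m (V *t 1%:M).
Proof.
have [/eqP] := support_tens0.
have -> : V *t (1%:M - V) = V *t 1%:M - V *t V.
  by apply/eqP; rewrite eq_sym subr_eq -tensmxDr subrK.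
by rewrite mulmxBr subr_eq0 => /eqP.
Qed.

Lemma support_tensr : A *m (V *t V) = A *m (1%:M *t V).
Proof.
have [_ /eqP] := support_tens0.
have -> : (1%:M - V) *t V = 1%:M *t V - V *t V.
  by apply/eqP; rewrite eq_sym subr_eq -tensmxDl subrK.
by rewrite mulmxBr subr_eq0 => /eqP.
Qed.

Lemma support_tens_comm : (V *t V) *m A = A *m (V *t V).
Proof.
rewrite A_def mulmx_suml mulmx_sumr; apply: eq_bigr => i _.
by rewrite -scalemxAl -scalemxAr !mxtens.tensmx_mul support_comm.
Qed.

(** As [A (V (x) 1) = A (1 (x) V)], pairing [T (V Y)] with [Z] is pairing [T Y] with [V Z]. Hence
    [T (V Y) = (T Y) V = l Y V]. *)
Lemma support_top_eigen (Y : 'M[C]_k) : top_eigen Y ->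
  V *m Y = Y *m V /\ top_eigen (V *m Y).
Proof.
move=> WY; have [[hV VV] _ _] := V_supp; have [hY TY] := WY.
have VY : V *m Y = Y *m V.
  rewrite (top_eigen_span WY) -scalemxAr -scalemxAl mulmx_sumr mulmx_suml.
  congr (_ *: _); apply: eq_bigr => i _.
  by rewrite -scalemxAr -scalemxAl support_comm.
split=> //; split; first by rewrite adjmxM hY hV VY.
apply: mxtrace_mul_inj => Z.
rewrite -schmidt_op_tens -[Z in LHS]mul1mx -mxtens.tensmx_mul mulmxA.
rewrite -support_tensl support_tensr -mulmxA mxtens.tensmx_mul mul1mx.
by rewrite schmidt_op_tens TY mulmxA -scalemxAl -VY.
Qed.

End Support.

(** An orthonormal basis of the top eigenvectors fixed by [P], kept as a sequence since its length
    is known only after the recursive splitting. *)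
Definition psd_onb (P : 'M[C]_k) (s : seq 'M[C]_k) :=
  [/\ uniq s,
      {in s, forall e, [/\ psdmx e, top_eigen e & P *m e = e]},
      {in s &, forall e f, \tr (e *m f) = (e == f)%:R}
    & forall X, top_eigen X -> P *m X = X ->
        X = \sum_(e <- s) \tr (X *m e) *: e].

Definition top_stable (P : 'M[C]_k) :=
  forall Y, top_eigen Y -> P *m Y = Y *m P /\ top_eigen (P *m Y).

(** Write [X = V X + (P - V) X] and expand each summand in its own basis. Cross terms vanish because
    [V (P - V) = 0]. *)
Lemma psd_onb_cat (P V : 'M[C]_k) (s1 s2 : seq 'M[C]_k) :
  herm_idem P -> herm_idem V -> P *m V = V ->
  top_stable P -> top_stable V ->
  psd_onb V s1 -> psd_onb (P - V) s2 -> psd_onb P (s1 ++ s2).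
Proof.
move=> [hP PP] [hV VV] PV stP stV [u1 S1 on1 sp1] [u2 S2 on2 sp2].
have VP := herm_absorb hP hV PV.
have s12 e f : e \in s1 -> f \in s2 -> \tr (e *m f) = 0.
  move=> /S1[pe _ Ve] /S2[pf _ PVf].
  rewrite -(psdmx_herm pe) -Ve adjmxM hV -PVf mulmxA -(mulmxA _ V).
  by rewrite mulmxBr VP VV subrr mulmx0 mul0mx linear0.
have disj e : e \in s1 -> e \in s2 -> False.
  move=> e1 e2; have /eqP := s12 _ _ e1 e2.
  by rewrite on1 // eqxx oner_eq0.
split.
- rewrite cat_uniq u1 u2 andbT /=; apply/hasPn => e e2; apply/negP => e1.
  exact: disj e1 e2.
- move=> e; rewrite mem_cat => /orP[/S1[pe We Ve]|/S2[pe We Ve]]; split=> //.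
    by rewrite -Ve mulmxA PV.
  by rewrite -Ve mulmxA mulmxBr PP PV.
- move=> e f; rewrite !mem_cat => /orP[e1|e2] /orP[f1|f2].
  + exact: on1.
  + by rewrite s12 //; case: eqP => // ef; case: (disj e); rewrite // ef.
  + rewrite mxtrace_mulC s12 //; case: eqP => // ef.
    by case: (disj f); rewrite // -ef.
  + exact: on2.
- move=> X WX PX; have [VX WVX] := stV _ WX.
  have WX' : top_eigen ((P - V) *m X).
    by rewrite mulmxBl; apply: top_eigen_sub => //; have [] := stP _ WX.
  rewrite big_cat /= -[LHS]PX -[P in P *m X](subrK V) mulmxDl addrC.
  rewrite [V *m X]sp1 //; last by rewrite mulmxA VV.
  rewrite [(P - V) *m X]sp2 //; last first.
    by rewrite mulmxA mulmxBl !mulmxBr PP PV VP VV subrr subr0.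
  congr (_ + _); apply: eq_big_seq => e es; last first.
    by have [_ _ Ve] := S1 _ es; rewrite VX -mulmxA Ve.
  have [_ _ Ve] := S2 _ es; congr (_ *: _); rewrite -[in RHS]Ve.
  have [PX' _] := stP _ WX.
  by rewrite mulmxBl PX' VX -mulmxBr mulmxA.
Qed.

(** Induction on the rank of [P]. Two nonzero positive semidefinite elements with product zero give
    a split into [V], the support of one of them, and [P - V], both of smaller rank. Without such a
    pair every element is positive semidefinite up to sign, which forces dimension at most one. *)
Lemma psd_onb_exists (P : 'M[C]_k) :
  herm_idem P -> top_stable P -> exists s, psd_onb P s.
Proof.
have [m] := ubnP (\rank P); elim: m P => // m IHm P rP hP stP.
have [hPh PP] := hP.
have [[X [Y [[X0 pX WX PX] [Y0 pY WY PY] XY0]]] | no_split] :=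
  pselect (exists X Y, [/\ [/\ X != 0, psdmx X, top_eigen X & P *m X = X],
    [/\ Y != 0, psdmx Y, top_eigen Y & P *m Y = Y] & X *m Y = 0]).
  have := herm_proj_support X; set V := herm_proj _ => VX.
  have [hV VXX [M EM]] := VX; have [hVh VV] := hV.
  have stV : top_stable V by move=> Z; apply: (support_top_eigen WX pX VX).
  have PV : P *m V = V by rewrite EM mulmxA PX.
  have VY : V *m Y = 0.
    have [hX _] := WX; have [hY _] := WY.
    apply: mulmx_adj_eq0 => //.
    by rewrite EM mulmxA (mulmx_adj_eq0 hX hY XY0) mul0mx.
  have VP : V != P.
    by apply: contraNneq Y0 => VP; rewrite -PY -VP VY.
  have V0 : P - V != P.
    rewrite -subr_eq0 addrAC subrr sub0r oppr_eq0.
    by apply: contraNneq X0 => V0; rewrite -VXX V0 mul0mx.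
  have hPV := herm_idem_sub hP hV PV.
  have [s1 on1] : exists s, psd_onb V s.
    by apply: IHm => //; apply: leq_trans (herm_idem_rank_lt _ _ _ _) rP.
  have [s2 on2] : exists s, psd_onb (P - V) s.
    apply: IHm => //.
      apply: leq_trans (herm_idem_rank_lt _ _ _ _) rP => //.
      by rewrite mulmxBr PP PV.
    move=> Z WZ; have [PZ WPZ] := stP _ WZ; have [VZ WVZ] := stV _ WZ.
    by rewrite mulmxBl mulmxBr PZ VZ -PZ -VZ; split=> //; apply: top_eigen_sub.
  exists (s1 ++ s2); exact: (psd_onb_cat hP hV PV stP stV on1 on2).
(* Both parts stay in the space and have product zero, so [no_split] makes one of them vanish. *)
have pos_part X : top_eigen X -> P *m X = X -> exists Q N,
    [/\ [/\ psdmx Q, top_eigen Q & P *m Q = Q],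
        [/\ psdmx N, top_eigen N & P *m N = N],
        X = Q - N & Q = 0 \/ N = 0].
  move=> WX PX; have [hX _] := WX.
  have [Q [N [pQ pN EX QN0 [M [M' [EQ EN]]]]]] := herm_pos_neg hX.
  have [WQ WN] := top_eigen_pos_part WX pQ pN EX QN0.
  have PQ : P *m Q = Q by rewrite EQ mulmxA PX.
  have PN : P *m N = N by rewrite EN mulmxA PX.
  exists Q, N; split=> //.
  have [->|Q0] := eqVneq Q 0; first by left.
  have [->|N0] := eqVneq N 0; first by right.
  by case: no_split; exists Q, N.
have [[X [WX PX X0]]|no_elt] :=
    pselect (exists X, [/\ top_eigen X, P *m X = X & X != 0]); last first.
  exists [::]; split=> // X WX PX; rewrite big_nil.
  by apply/eqP; apply: contra_notT no_elt => X0; exists X.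
have [e [pe We Pe te]] : exists e,
    [/\ psdmx e, top_eigen e, P *m e = e & \tr (e *m e) = 1].
  have [Q [pQ WQ PQ Q0]] :
      exists Q, [/\ psdmx Q, top_eigen Q, P *m Q = Q & Q != 0].
    have [Q [N [[pQ WQ PQ] [pN WN PN] EX [Q0|N0]]]] := pos_part X WX PX.
      exists N; split=> //; apply: contraNneq X0 => N0.
      by rewrite EX Q0 N0 subrr.
    exists Q; split=> //; apply: contraNneq X0 => Q0.
    by rewrite EX Q0 N0 subrr.
  have [r r_ge0 r1] := herm_normalize (psdmx_herm pQ) Q0.
  exists (r *: Q); split=> //; first exact: psdmxZ.
    by apply: top_eigen_scale => //; apply: ger0_real.
  by rewrite -scalemxAr PQ.
exists [:: e]; split=> //.
- by move=> f; rewrite inE => /eqP ->.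
- by move=> f h; rewrite !inE => /eqP -> /eqP ->; rewrite te eqxx.
move=> Y WY PY; rewrite big_seq1; set a := \tr _.
have [hY _] := WY; have he := psdmx_herm pe.
have a_real : a \is Num.real by apply: mxtrace_mul_real.
(* The component of [Y] orthogonal to [e] is positive semidefinite up to sign, and [kill] will make
   it zero. *)
have WZ : top_eigen (Y - a *: e).
  by apply: top_eigen_sub => //; apply: top_eigen_scale.
have PZ : P *m (Y - a *: e) = Y - a *: e.
  by rewrite mulmxBr PY -scalemxAr Pe.
have Ze : \tr ((Y - a *: e) *m e) = 0.
  by rewrite mulmxBl -scalemxAl linearB linearZ /= te mulr1 subrr.
(* [Q e = 0] would split the range of [P]. *)
have kill Q : psdmx Q -> top_eigen Q -> P *m Q = Q -> \tr (Q *m e) = 0 -> Q = 0.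
  move=> pQ WQ PQ Qe0; apply/eqP; apply: contra_notT no_split => Q0.
  exists Q, e; split=> //; last exact: psdmx_tr_eq0.
  split=> //; apply: contra_eq_neq te => ->.
  by rewrite mul0mx linear0 eq_sym oner_eq0.
apply/eqP; rewrite -subr_eq0; apply/eqP.
have [Q [N [[pQ WQ PQ] [pN WN PN] EZ QN]]] := pos_part _ WZ PZ.
move: Ze; rewrite EZ; case: QN => ->; rewrite ?sub0r ?subr0.
  rewrite mulNmx raddfN /= => /eqP; rewrite oppr_eq0 => /eqP /kill -> //.
  by rewrite oppr0.
by move/kill; apply.
Qed.

End TopEigenspace.
End SchmidtOperator.

(** * Orthonormal families *)

Section OrthonormalFamilies.
Variables (C : numClosedFieldType) (k : nat).

Lemma orthonormal_familyE (n : nat) (e : 'I_n -> 'M[C]_k) :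
  (forall i, (e i)^t* = e i) ->
  orthonormal_family e <-> forall i j, \tr (e i *m e j) = (i == j)%:R.
Proof.
by move=> he; split=> eon i j; have := eon i j; rewrite /hs_inner he.
Qed.

(** Expanding one tensor factor on each side turns both sums into the double sum of
    [tr (e_j f_i) f_i (x) e_j]. *)
Lemma onb_tens_eq (m p : nat) (e : 'I_m -> 'M[C]_k) (f : 'I_p -> 'M[C]_k) :
  (forall j, e j = \sum_i \tr (e j *m f i) *: f i) ->
  (forall i, f i = \sum_j \tr (f i *m e j) *: e j) ->
  \sum_j e j *t e j = \sum_i f i *t f i.
Proof.
move=> ef fe.
under eq_bigr => j _ do rewrite {1}(ef j) tensmx_suml.
under [RHS]eq_bigr => i _ do rewrite {2}(fe i) tensmx_sumr.
rewrite exchange_big; apply: eq_bigr => i _; apply: eq_bigr => j _ /=.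
by rewrite tensmxZl tensmxZr mxtrace_mulC.
Qed.

(** Each size is a sum of squared norms, and both sums expand to the double sum of the squares of
    [tr (e_j f_i)]. *)
Lemma onb_size (m p : nat) (e : 'I_m -> 'M[C]_k) (f : 'I_p -> 'M[C]_k) :
  (forall j, \tr (e j *m e j) = 1) -> (forall i, \tr (f i *m f i) = 1) ->
  (forall j, e j = \sum_i \tr (e j *m f i) *: f i) ->
  (forall i, f i = \sum_j \tr (f i *m e j) *: e j) ->
  m = p.
Proof.
move=> e1 f1 ef fe; apply/eqP; rewrite -(eqr_nat C); apply/eqP.
have -> : m%:R = \sum_j \tr (e j *m e j) :> C.
  by under eq_bigr do rewrite e1; rewrite sumr_const card_ord.
have -> : p%:R = \sum_i \tr (f i *m f i) :> C.
  by under eq_bigr do rewrite f1; rewrite sumr_const card_ord.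
under eq_bigr => j _ do rewrite {1}(ef j) mulmx_suml raddf_sum.
under [RHS]eq_bigr => i _ do rewrite {1}(fe i) mulmx_suml raddf_sum.
rewrite exchange_big; apply: eq_bigr => i _; apply: eq_bigr => j _ /=.
by rewrite -!scalemxAl !linearZ /= (mxtrace_mulC (e j)).
Qed.

(** The traces [tr (A (X (x) Y))] determine the map and depend only on the tensor [A]. *)
Lemma schmidt_op_unique (m p : nat) (a : 'I_m -> C) (b : 'I_p -> C)
    (e : 'I_m -> 'M[C]_k) (f : 'I_p -> 'M[C]_k) (X : 'M[C]_k) :
  \sum_j a j *: (e j *t e j) = \sum_i b i *: (f i *t f i) ->
  schmidt_op a e X = schmidt_op b f X.
Proof.
move=> ef; apply: mxtrace_mul_inj => Y.
by rewrite -(schmidt_op_tens erefl) ef (schmidt_op_tens erefl).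
Qed.

(* The coefficient matrix [tr (e i * f j)] has orthonormal rows and nonnegative
   entries, so distinct rows have disjoint supports. *)
Lemma psd_onb_perm (s : nat) (e f : 'I_s -> 'M[C]_k) :
  (forall i, psdmx (e i)) -> (forall i, psdmx (f i)) ->
  (forall i j, \tr (e i *m e j) = (i == j)%:R) ->
  (forall i j, \tr (f i *m f j) = (i == j)%:R) ->
  (forall i, e i = \sum_j \tr (e i *m f j) *: f j) ->
  exists sigma : 'S_s, forall i, e i = f (sigma i).
Proof.
move=> pe pf eon fon ef; pose c i j := \tr (e i *m f j).
have c_ge0 i j : 0 <= c i j by apply: psdmx_tr_ge0.
have row i i' : \sum_j c i j * c i' j = (i == i')%:R.
  rewrite -eon [in RHS](ef i) mulmx_suml raddf_sum; apply: eq_bigr => j _ /=.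
  by rewrite -scalemxAl linearZ /= (mxtrace_mulC (f j)).
have disj i i' j : i != i' -> c i j != 0 -> c i' j = 0.
  move=> ii' cij; have /eqP := row i i'; rewrite (negPf ii').
  rewrite psumr_eq0 => [/allP/(_ j)|j' _]; last exact: mulr_ge0.
  by rewrite mem_index_enum mulf_eq0 (negPf cij) => /(_ isT) /eqP.
have supp i : {j | c i j != 0}.
  apply/sigW/existsP; apply: contraT; rewrite negb_exists => /forallP c0.
  have /eqP := row i i; rewrite eqxx big1 ?[0 == _]eq_sym ?oner_eq0 // => j _.
  by have := c0 j; rewrite negbK => /eqP ->; rewrite mul0r.
have inj : injective (fun i => sval (supp i)).
  move=> i i' ii'; apply/eqP; apply: contraT => ne.
  have := svalP (supp i'); rewrite -ii'.
  by rewrite (disj _ _ _ ne) ?eqxx //; exact: svalP (supp i).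
exists (perm inj) => i; rewrite permE; set j := sval _.
(* An injection of ['I_s] is onto, so column [j'] is chosen by another row, whose support is
   disjoint from that of row [i]. *)
have only j' : j' != j -> c i j' = 0.
  rewrite -(permKV (perm inj) j') permE; move: (_ j') => i' ne.
  by apply: (disj i'); [apply: contraNneq ne => -> | exact: svalP (supp i')].
have EX : e i = c i j *: f j.
  rewrite {1}(ef i) (bigD1 j) //= big1 ?addr0 // => j' ne.
  by rewrite -/(c i j') only // scale0r.
have := row i i; rewrite eqxx (bigD1 j) //= big1 => [|j' ne].
  rewrite addr0 -expr2 => /eqP; rewrite sqrf_eq1 => /orP[/eqP c1|/eqP cN1].
    by rewrite EX c1 scale1r.
  by have := c_ge0 i j; rewrite cN1 oppr_ge0 ler10.
by rewrite only // mul0r.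
Qed.

End OrthonormalFamilies.

(** * Compressions of SPC matrices *)

Section Compression.
Variables (C : numClosedFieldType) (k : nat).

(** An eigenvector [u] of the Gram matrix with nonzero eigenvalue yields the eigenvector
    [\sum_i u_i X_i] of the induced map, with the same eigenvalue. *)
Lemma gram_eigenvector (n : nat) (X : 'I_n -> 'M[C]_k) :
  (forall i, (X i)^t* = X i) -> (exists i, X i != 0) ->
  exists (mu : C) (e : 'M[C]_k), [/\ mu != 0, e^t* = e, \tr (e *m e) = 1 &
    schmidt_op (fun=> 1) X e = mu *: e].
Proof.
move=> hX [i0 Xi0]; pose Q : 'M[C]_n := \matrix_(i, j) \tr (X i *m X j).
have hQ : Q \is hermsymmx.
  apply/hermsymmxP/matrixP => i j; rewrite !mxE /=.
  rewrite conj_Creal ?mxtrace_mul_real //; exact: mxtrace_mulC.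
have EQ := orthomx_spectralP (hermitian_normalmx hQ).
have /mxOverP d_real := hermitian_spectral_diag_real hQ.
set U := spectralmx Q in EQ; set d := spectral_diag Q in EQ d_real.
have uU : U \is unitarymx := spectral_unitarymx Q.
(* Otherwise [Q = 0], although its entry at [i0] is the squared norm of [X i0]. *)
have [j dj] : exists j, d 0 j != 0.
  apply/existsP; apply: contraT; rewrite negb_exists => /forallP d0.
  have := herm_sqr_gt0 (hX i0) Xi0.
  suff -> : \tr (X i0 *m X i0) = 0 by rewrite ltxx.
  have -> : \tr (X i0 *m X i0) = Q i0 i0 by rewrite mxE.
  rewrite EQ (_ : d = 0); first by rewrite linear0 mulmx0 mul0mx mxE.
  by apply/rowP => j; rewrite mxE; have := d0 j; rewrite negbK => /eqP.
have vQ : row j U *m Q = d 0 j *: row j U.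
  rewrite EQ !mulmxA -row_mul mulmxV ?spectral_unit // -row_mul mul1mx.
  by rewrite row_diag_mx -scalemxAl -rowE.
pose Y := \sum_i U j i *: X i.
have trY i : \tr (X i *m Y) = d 0 j * U j i.
  have := congr1 (fun w : 'rV_n => w 0 i) vQ; rewrite !mxE => <-.
  rewrite mulmx_sumr raddf_sum; apply: eq_bigr => i' _ /=.
  by rewrite !mxE -scalemxAr linearZ /= mxtrace_mulC.
have Y0 : Y != 0.
  apply/eqP => Y0; have : row j U *m (row j U)^t* = 1.
    apply/rowP => a; rewrite !ord1.
    have /row_unitarymxP/(_ j j) := uU; rewrite dotmxE eqxx => ->.
    by rewrite mxE eqxx.
  suff -> : row j U = 0 by rewrite mul0mx => /eqP; rewrite eq_sym oner_eq0.
  apply/rowP => i; rewrite !mxE; have /eqP := trY i.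
  by rewrite Y0 mulmx0 linear0 eq_sym mulf_eq0 (negPf dj) => /eqP.
have TY : schmidt_op (fun=> 1) X Y = d 0 j *: Y.
  rewrite /schmidt_op scaler_sumr; apply: eq_bigr => i _.
  by rewrite mul1r trY scalerA.
have TYa : schmidt_op (fun=> 1) X (Y^t*) = d 0 j *: Y^t*.
  have := congr1 (fun Z : 'M_k => Z^t*) TY.
  rewrite adjmxZ (CrealP (d_real _ _)) => <-.
  rewrite /schmidt_op [RHS]adjmx_sum; apply: eq_bigr => i _.
  rewrite adjmxZ hX !mul1r.
  by rewrite -mxtrace_adj adjmxM hX mxtrace_mulC.
(* [Y] and its adjoint share a real eigenvalue, so their sum is a Hermitian eigenvector unless [Y]
   is skew-Hermitian; then ['i *: Y] serves. *)
have [E [hE E0 TE]] : exists E, [/\ E^t* = E, E != 0 &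
    schmidt_op (fun=> 1) X E = d 0 j *: E].
  have [YN|YN] := eqVneq (Y - (- Y^t*)) 0; last first.
    exists (Y - (- Y^t*)); split=> //.
      by rewrite opprK adjmxD trmxCK addrC.
    rewrite schmidt_opB TY -[- Y^t*]scaleN1r schmidt_opZ TYa scalerBr.
    by rewrite !scalerA mulrC.
  exists ('i *: Y); split; last first.
  - by rewrite schmidt_opZ TY !scalerA mulrC.
  - by rewrite scaler_eq0 negb_or neq0Ci.
  - move/eqP: YN; rewrite subr_eq0 => /eqP YN.
    by rewrite adjmxZ conjCi [in RHS]YN scaleNr scalerN.
have [r r_ge0 r1] := herm_normalize hE E0.
exists (d 0 j), (r *: E); split=> //; first by rewrite adjmxZ hE geC0_conj.
by rewrite schmidt_opZ TE !scalerA mulrC.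
Qed.

(* Deflation: an eigenvector [e] of the induced map is split off by replacing
   each [X i] with its component orthogonal to [e]. *)
Lemma herm_tens_schmidt (n : nat) (X : 'I_n -> 'M[C]_k) :
  (forall i, (X i)^t* = X i) ->
  exists (m : nat) (lam : 'I_m -> C) (e : 'I_m -> 'M[C]_k),
    hermitian_schmidt (\sum_i X i *t X i) lam e e.
Proof.
(* The rank of [M X] is the dimension of the span of the family, which is the induction measure. *)
pose M (X : 'I_n -> 'M[C]_k) := \matrix_i mxvec (X i).
have [r] := ubnP (\rank (M X)); elim: r X => // r IHr X rX hX.
have [X0|X0] := pselect (exists i, X i != 0); last first.
  have on0 : orthonormal_family (fun _ : 'I_0 => 0 : 'M[C]_k) by case.
  exists 0, (fun=> 0), (fun=> 0); split=> //; try by case.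
  rewrite big_ord0; apply: big1 => i _.
  suff -> : X i = 0 by rewrite mxtens.tens0mx.
  by apply/eqP; apply: contra_notT X0 => Xi; exists i.
have [mu [e [mu0 he e1 Te]]] := gram_eigenvector hX X0.
pose c i := \tr (X i *m e); pose X' i := X i - c i *: e.
have c_real i : c i \is Num.real by apply: mxtrace_mul_real.
have hX' i : (X' i)^t* = X' i.
  by rewrite adjmxD adjmxN adjmxZ hX he (CrealP (c_real i)).
have X'e i : \tr (X' i *m e) = 0.
  by rewrite mulmxBl linearB /= -scalemxAl linearZ /= e1 mulr1 subrr.
have sum_c : \sum_i c i *: X i = mu *: e.
  by rewrite -Te; apply: eq_bigr => i _; rewrite mul1r.
have sum_cc : \sum_i c i * c i = mu.
  have := congr1 (fun Z => \tr (Z *m e)) sum_c.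
  rewrite -scalemxAl linearZ /= e1 mulr1 => <-.
  rewrite mulmx_suml raddf_sum; apply: eq_bigr => i _ /=.
  by rewrite -scalemxAl linearZ.
have mu_gt0 : 0 < mu.
  rewrite lt_neqAle eq_sym mu0 -sum_cc sumr_ge0 // => i _.
  by rewrite -expr2 real_exprn_even_ge0.
have EX : \sum_i X i *t X i = mu *: (e *t e) + \sum_i X' i *t X' i.
  have -> : \sum_i X i *t X i = \sum_i ((c i *: X' i) *t e +
      e *t (c i *: X' i) + (c i * c i) *: (e *t e) + X' i *t X' i).
    apply: eq_bigr => i _; have : X i = X' i + c i *: e by rewrite subrK.
    move: (X i) (X' i) => _ Z ->.
    rewrite tensmxDl !tensmxDr !tensmxZl !tensmxZr scalerA.
    by rewrite [RHS]addrC !addrA.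
  (* This sum is one factor of each mixed term with [e], so the mixed terms cancel. *)
  have cX' : \sum_i c i *: X' i = 0.
    under eq_bigr do rewrite scalerBr scalerA.
    by rewrite sumrB sum_c -scaler_suml sum_cc subrr.
  rewrite !big_split /= -tensmx_suml -tensmx_sumr cX' -scaler_suml sum_cc.
  by rewrite mxtens.tens0mx mxtens.tensmx0 !add0r.
have [m [lam [f [lam0 hf fon _ EX']]]] : exists (m : nat) (lam : 'I_m -> C) f,
    hermitian_schmidt (\sum_i X' i *t X' i) lam f f.
  apply: IHr hX'; rewrite ltnS in rX; apply: leq_trans rX.
  (* As [mu] is nonzero, [e] lies in the span of the [X i]; it is not in the span of the [X' i],
     which are orthogonal to it. So the rank drops strictly. *)
  have ve : (mxvec e <= M X)%MS.
    have -> : mxvec e = mu^-1 *: \sum_i c i *: row i (M X).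
      have -> : e = mu^-1 *: \sum_i c i *: X i.
        by rewrite sum_c scalerA mulVf ?scale1r.
      rewrite linearZ linear_sum /=; congr (_ *: _); apply: eq_bigr => i _.
      by rewrite linearZ /= rowK.
    apply: scalemx_sub; apply: summx_sub => i _.
    by rewrite scalemx_sub // row_sub.
  have leX : (M X' <= M X)%MS.
    apply/row_subP => i; rewrite rowK linearB linearZ /= addmx_sub ?eqmx_opp //.
      by rewrite -[mxvec _](rowK (fun i => mxvec (X i))) row_sub.
    by rewrite scalemx_sub.
  rewrite ltn_neqAle mxrankS // andbT mxrank_leqif_sup //.
  apply/negP => /(submx_trans ve)/submxP[D ED].
  have Ee : e = \sum_i D 0 i *: X' i.
    apply: (can_inj mxvecK); rewrite ED mulmx_sum_row linear_sum.
    by apply: eq_bigr => i _; rewrite linearZ /= rowK.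
  have /eqP := e1; rewrite {1}Ee mulmx_suml raddf_sum big1 /= => [|i _].
    by rewrite eq_sym oner_eq0.
  by rewrite -scalemxAl linearZ /= X'e mulr0.
have {}hf i : (f i)^t* = f i by have [/hermsymmxP] := hf i.
have {}fon := (orthonormal_familyE hf).1 fon.
(* The map induced by the deflated tensor kills [e]. Computed through the [f i] and paired with
   [f j], it gives [lam_j tr (f_j e) = 0]. *)
have fe j : \tr (f j *m e) = 0.
  have EX1 : \sum_i 1 *: (X' i *t X' i) = \sum_i lam i *: (f i *t f i).
    by rewrite -EX'; apply: eq_bigr => i _; rewrite scale1r.
  have := congr1 (fun Z => \tr (Z *m f j)) (schmidt_op_unique e EX1).
  rewrite !schmidt_op_trE big1 => [|i _]; last by rewrite X'e mulr0 mul0r.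
  rewrite (bigD1 j) //= fon eqxx mulr1 big1 => [|i ij].
    move=> /esym/eqP; rewrite addr0 mulf_eq0 gt_eqF //= => /eqP //.
  by rewrite fon (negPf ij) mulr0.
pose lam' i := oapp lam mu (unlift ord0 i).
pose f' i := oapp f e (unlift ord0 i).
have hf' i : (f' i)^t* = f' i by rewrite /f'; case: unlift => [j|] /=.
have f'on : orthonormal_family f'.
  apply/(orthonormal_familyE hf') => i j; rewrite /f'.
  case: (unliftP ord0 i) => [i' ->|->]; case: (unliftP ord0 j) => [j' ->|->] /=.
  - by rewrite fon (inj_eq lift_inj).
  - by rewrite fe.
  - by rewrite mxtrace_mulC fe.
  - by rewrite e1.
exists m.+1, lam', f'; split=> //.
- by move=> i; rewrite /lam'; case: unlift => [j|] /=.
- by move=> i; split; apply/hermsymmxP.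
rewrite EX EX' big_ord_recl /lam' /f' unlift_none /=; congr (_ + _).
by apply: eq_bigr => i _; rewrite liftK.
Qed.

(** The compressed factors [V g_i V] stay Hermitian but may lose orthonormality. Absorbing the
    square roots of the coefficients gives a sum to which [herm_tens_schmidt] applies. *)
Lemma compress_SPC (V : 'M[C]_k) (A : 'M[C]_(k * k)) :
  V^t* = V -> is_SPC A -> is_SPC (compress V A).
Proof.
move=> hV [pA [n [lam [g [lam0 hg _ _ EA]]]]]; split.
  have := psdmx_conj (V *t V) pA.
  by rewrite tensmx_adj hV.
pose X i := sqrtC (lam i) *: (V *m g i *m V).
have hX i : (X i)^t* = X i.
  rewrite adjmxZ geC0_conj ?sqrtC_ge0 ?ltW //.
  by have [/hermsymmxP hgi _] := hg i; rewrite !adjmxM hV hgi mulmxA.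
have -> : compress V A = \sum_i X i *t X i; last exact: herm_tens_schmidt.
rewrite /compress EA mulmx_sumr mulmx_suml; apply: eq_bigr => i _.
rewrite -scalemxAr -scalemxAl !mxtens.tensmx_mul /X tensmxZl tensmxZr scalerA.
by rewrite -expr2 sqrtCK.
Qed.

End Compression.

(** * The block decomposition *)

Section Blocks.
Variables (C : numClosedFieldType) (k s : nat) (e : 'I_s -> 'M[C]_k).
Hypotheses (e_psd : forall i, psdmx (e i)).
Hypothesis e_on : forall i j, \tr (e i *m e j) = (i == j)%:R.

Let V (i : 'I_s) := herm_proj (colspace (e i)).

Lemma psd_on_mul0 (i j : 'I_s) : i != j -> e i *m e j = 0.
Proof. by move=> ij; apply: psdmx_tr_eq0 => //; rewrite e_on (negPf ij). Qed.

(** Distinct [e i] have product zero, so their column spaces are mutually orthogonal. *)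
Lemma colspace_direct : mxdirect (\sum_(i < s) colspace (e i))%MS.
Proof.
apply/mxdirect_sumsP => i _; apply: orthomx_disj; apply/orthomx1P.
set S := (\sum_(j | _) _)%MS.
have S0 : S *m (e i)^T = 0.
  apply/sub_kermxP/sumsmx_subP => j ji; apply/sub_kermxP.
  by rewrite -trmx_mul psd_on_mul0 ?trmx0 // eq_sym.
have -> : colspace (e i) = (colspace (e i))^t*.
  by rewrite -[in LHS](psdmx_herm (e_psd i)) /colspace map_trmx.
by rewrite -adjmxM /colspace S0 trmx0 map_mx0.
Qed.

Lemma support_mul0 (i j : 'I_s) : i != j -> V i *m e j = 0.
Proof.
move=> ij; have [[hV _] _ [M EV]] := herm_proj_support (e i).
by rewrite /V -hV EV adjmxM -mulmxA (psdmx_herm (e_psd i)) psd_on_mul0 ?mulmx0.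
Qed.

(** The sum of the [V i] has image inside the sum of the column spaces and fixes every [e i]; with
    self-adjointness this characterizes the projection. *)
Lemma herm_proj_sum :
  herm_proj (\sum_(i < s) colspace (e i))%MS = \sum_(i < s) V i.
Proof.
rewrite -[RHS]trmxK; congr trmx; apply: proj_ortho_unique.
  rewrite raddf_sum; apply: summx_sub => i _ /=.
  by rewrite /V /herm_proj trmxK proj_orthoE (sumsmx_sup i).
have hV : (\sum_i V i)^T^t* = (\sum_i V i)^T.
  rewrite -map_trmx adjmx_sum; congr trmx; apply: eq_bigr => i _.
  by have [[]] := herm_proj_support (e i).
have S0 : (\sum_(i < s) colspace (e i))%MS *m (1%:M - (\sum_i V i)^T) = 0.
  apply/sub_kermxP/sumsmx_subP => i _; apply/sub_kermxP.
  rewrite mulmxBr mulmx1 -trmx_mul mulmx_suml (bigD1 i) //= big1 => [|j ji].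
    by have [_ -> _] := herm_proj_support (e i); rewrite addr0 /colspace subrr.
  exact: support_mul0.
rewrite -[LHS]trmxCK adjmxM trmxCK adjmxD adjmxN adjmx1 hV S0.
by rewrite trmx0 map_mx0.
Qed.

Lemma image_projs_lift (i : 'I_s) : image_projs e (lift ord_max i) = V i.
Proof. by rewrite /image_projs liftK. Qed.

Lemma image_projs_max : image_projs e ord_max = 1%:M - \sum_(i < s) V i.
Proof.
rewrite /image_projs unlift_none -herm_proj_sum /herm_proj.
apply/eqP; rewrite eq_sym subr_eq -linearD /=; apply/eqP.
have := add_proj_ortho (\sum_(i < s) colspace (e i))%MS (1%:M : 'M[C]_k).
by rewrite !mul1mx addrC => ->; rewrite trmx1.
Qed.

Lemma image_projs_sum : \sum_(j < s.+1) image_projs e j = 1%:M.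
Proof.
rewrite (bigD1_ord ord_max) //= image_projs_max.
by under eq_bigr do rewrite image_projs_lift; rewrite subrK.
Qed.

Lemma image_projs_herm_idem (j : 'I_s.+1) : herm_idem (image_projs e j).
Proof.
by rewrite /image_projs; case: unlift => [i|]; apply: herm_proj_herm_idem.
Qed.

(** Factoring [W (x) W = (W (x) 1) (1 (x) W)] reduces [A (W (x) W)] to [A (W (x) 1)]. This is
    self-adjoint, so [W (x) W] commutes with [A] and the left factor is absorbed. *)
Lemma compressE (W : 'M[C]_k) (A : 'M[C]_(k * k)) :
  herm_idem W -> A^t* = A -> (A *m (W *t 1%:M))^t* = A *m (W *t 1%:M) ->
  A *m (W *t 1%:M) = A *m (1%:M *t W) -> compress W A = A *m (W *t 1%:M).
Proof.
move=> [hW WW] hA hAW AW.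
have AWW : A *m (W *t W) = A *m (W *t 1%:M).
  rewrite -[W in X in _ *t X]mul1mx -[W in W *t _]mulmx1.
  rewrite -mxtens.tensmx_mul mulmxA AW -mulmxA mxtens.tensmx_mul.
  by rewrite mulmx1 WW.
have WWA : (W *t W) *m A = A *m (W *t W).
  by rewrite AWW -hAW -AWW adjmxM hA tensmx_adj hW.
by rewrite /compress WWA -mulmxA mxtens.tensmx_mul WW AWW.
Qed.

(** Every compression equals [A] times the projection in one tensor factor; the complementary
    projection inherits the needed identities by linearity. The projections sum to the identity. *)
Lemma compress_decomposition (A : 'M[C]_(k * k)) : A^t* = A ->
  (forall i, A *m (V i *t V i) = A *m (V i *t 1%:M)) ->
  (forall i, A *m (V i *t V i) = A *m (1%:M *t V i)) ->
  (forall i, (V i *t V i) *m A = A *m (V i *t V i)) ->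
  A = \sum_(j < s.+1) compress (image_projs e j) A.
Proof.
move=> hA Al Ar Ac.
have hAV i : (A *m (V i *t 1%:M))^t* = A *m (V i *t 1%:M).
  have [hV _] := herm_proj_herm_idem (colspace (e i)).
  by rewrite -Al adjmxM tensmx_adj hV hA Ac.
have EQ : A *m (image_projs e ord_max *t 1%:M) = A - \sum_i A *m (V i *t 1%:M).
  rewrite image_projs_max -mulmx_sumr -tensmx_suml -[X in _ = X - _]mulmx1.
  rewrite -tensmx11 -mulmxBr; congr (_ *m _); apply/eqP.
  by rewrite eq_sym subr_eq -tensmxDl subrK.
have EQ' : A *m (1%:M *t image_projs e ord_max) = A - \sum_i A *m (V i *t 1%:M).
  under eq_bigr => i _ do rewrite -Al Ar.
  rewrite image_projs_max -mulmx_sumr -tensmx_sumr -[X in _ = X - _]mulmx1.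
  rewrite -tensmx11 -mulmxBr; congr (_ *m _); apply/eqP.
  by rewrite eq_sym subr_eq -tensmxDr subrK.
have -> : \sum_j compress (image_projs e j) A =
    \sum_j A *m (image_projs e j *t 1%:M).
  apply: eq_bigr => j _; apply: compressE => //.
  - exact: image_projs_herm_idem.
  - case: (unliftP ord_max j) => [i ->|->]; first by rewrite image_projs_lift.
    rewrite EQ adjmxD adjmxN adjmx_sum hA; congr (_ - _).
    by apply: eq_bigr => i _; rewrite hAV.
  - case: (unliftP ord_max j) => [i ->|->]; last by rewrite EQ EQ'.
    by rewrite image_projs_lift -Al Ar.
by rewrite -mulmx_sumr -tensmx_suml image_projs_sum tensmx11 mulmx1.
Qed.

End Blocks.

(** The map induced by [D] fixes each [e i]; evaluating it through the [f j] gives the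
    coordinates. *)
Lemma psd_schmidt_coords (C : numClosedFieldType) (k m p : nat)
    (D : 'M[C]_(k * k)) (e : 'I_m -> 'M[C]_k) (f : 'I_p -> 'M[C]_k) :
  hermitian_schmidt D (fun=> 1) e e -> D = \sum_i f i *t f i ->
  forall i, e i = \sum_j \tr (e i *m f j) *: f j.
Proof.
move=> [_ he /orthonormal_familyE eon _ ED] EDf i.
have {}eon := eon (fun i => hermsymmxP _ (proj1 (he i))).
have := schmidt_op_gen (fun=> 1) eon i; rewrite scale1r => {1}<-.
rewrite (@schmidt_op_unique _ _ _ _ _ (fun=> 1) _ f).
  by apply: eq_bigr => j _; rewrite mul1r mxtrace_mulC.
by rewrite -ED EDf; apply: eq_bigr => j _; rewrite scale1r.
Qed.

(** * The top block of [A] and its positive semidefinite decompositions *)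

Section TopBlock.
Variables (C : numClosedFieldType) (k n s : nat) (A : 'M[C]_(k * k)).
Variables (lam : 'I_n -> C) (g : 'I_n -> 'M[C]_k) (l : C).
Hypotheses (A_psd : psdmx A) (A_dec : hermitian_schmidt A lam g g).
Hypotheses (l_gt0 : 0 < l) (le_sn : (s <= n)%N).
Hypothesis lam_top : forall i : 'I_n, (i < s)%N -> lam i = l.
Hypothesis lam_low : forall i : 'I_n, (s <= i)%N -> lam i < l.

Let D := \sum_(i < n | (i < s)%N) (g i *t g i).
Let gs (i : 'I_s) := g (widen_ord le_sn i).

Definition psd_schmidt (e : 'I_s -> 'M[C]_k) :=
  hermitian_schmidt D (fun=> 1) e e /\ (forall i, psdmx (e i)).

Let lam_gt0 i : 0 < lam i. Proof. by have [] := A_dec. Qed.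
Let g_herm i : (g i)^t* = g i.
Proof. by have [_ /(_ i) [/hermsymmxP]] := A_dec. Qed.
Let g_on i j : \tr (g i *m g j) = (i == j)%:R.
Proof. by have [_ _ /orthonormal_familyE -> //] := A_dec. Qed.
Let A_def : A = \sum_i lam i *: (g i *t g i).
Proof. by have [] := A_dec. Qed.
Let lam_le i : lam i <= l.
Proof.
by case: (ltnP i s) => [/lam_top ->|/lam_low /ltW].
Qed.
Let D_def : D = \sum_i gs i *t gs i.
Proof. exact: big_ord_narrow. Qed.
Let gs_on i j : \tr (gs i *m gs j) = (i == j)%:R.
Proof. by rewrite g_on. Qed.

Lemma top_eigen_gs (i : 'I_s) : top_eigen lam g l (gs i).
Proof.
by split; [exact: g_herm | rewrite (schmidt_op_gen _ g_on) lam_top //=].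
Qed.

(** Eigenvectors of the symmetric map for different eigenvalues are orthogonal, so only indices
    below [s] contribute. *)
Lemma top_eigen_coords (X : 'M[C]_k) : top_eigen lam g l X ->
  X = \sum_i \tr (X *m gs i) *: gs i.
Proof.
move=> WX; have [_ TX] := WX; rewrite {1}(top_eigen_span l_gt0 WX).
have low0 (j : 'I_n) : (s <= j)%N -> \tr (g j *m X) = 0.
  move=> sj; have := congr1 (fun Z => \tr (Z *m g j)) TX.
  rewrite schmidt_op_sym (schmidt_op_gen _ g_on) -!scalemxAl !linearZ /=.
  rewrite (mxtrace_mulC X) => /eqP.
  by rewrite -subr_eq0 -mulrBl mulf_eq0 subr_eq0 (lt_eqF (lam_low sj)) => /eqP.
rewrite (bigID (fun j : 'I_n => (j < s)%N)) /=.
rewrite [X in _ + X]big1 => [|j]; last first.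
  by rewrite -leqNgt => /low0 ->; rewrite mulr0 scale0r.
rewrite addr0 (big_ord_narrow le_sn) scaler_sumr; apply: eq_bigr => i _.
rewrite scalerA lam_top //= mulrA mulVf ?gt_eqF // mul1r.
by rewrite mxtrace_mulC.
Qed.

(** Splitting from [P = 1] gives a positive semidefinite basis of the whole top eigenspace. The [gs]
    form another basis, so the sizes agree and both produce [D]. *)
Lemma psd_schmidt_exists : exists e, psd_schmidt e.
Proof.
have h1 : herm_idem (1%:M : 'M[C]_k) by split; rewrite ?adjmx1 ?mulmx1.
have st1 : top_stable lam g l 1%:M by move=> Y WY; rewrite mul1mx mulmx1.
have [r [ur pr onr spr]] :=
  psd_onb_exists lam_gt0 g_herm g_on A_def A_psd l_gt0 lam_le h1 st1.
(* A free bound [m] avoids casts of ordinals, since [s = size r] is proved only below. *)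
pose e m (i : 'I_m) := r`_i.
have e_r m (i : 'I_m) : m = size r -> e m i \in r.
  by move=> Em; apply: mem_nth; rewrite -Em.
have e_on m (i j : 'I_m) : m = size r -> \tr (e m i *m e m j) = (i == j)%:R.
  by move=> Em; rewrite onr ?e_r // nth_uniq // -Em.
have e_span m X : m = size r -> top_eigen lam g l X ->
    X = \sum_(i < m) \tr (X *m e m i) *: e m i.
  move=> Em WX; rewrite {1}(spr X WX) ?mul1mx //.
  by rewrite (big_nth 0) big_mkord Em.
have e_top m (i : 'I_m) : m = size r -> top_eigen lam g l (e m i).
  by move=> Em; have [] := pr _ (e_r _ i Em).
have Es : s = size r.
  apply: (@onb_size _ _ _ _ gs (e (size r))).
  - by move=> i; rewrite gs_on eqxx.
  - by move=> i; rewrite e_on // eqxx.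
  - by move=> i; apply: e_span => //; apply: top_eigen_gs.
  - by move=> i; apply: top_eigen_coords; apply: e_top.
have e_psd i : psdmx (e s i) by have [] := pr _ (e_r _ i Es).
have e_onf : orthonormal_family (e s).
  by apply/orthonormal_familyE => [i|i j]; [apply: psdmx_herm | apply: e_on].
exists (e s); split=> //; split=> //.
  by move=> i; have [] := e_psd i.
under eq_bigr do rewrite scale1r.
rewrite D_def; apply: onb_tens_eq => i.
  by apply: e_span => //; apply: top_eigen_gs.
by apply: top_eigen_coords; apply: e_top.
Qed.

Lemma psd_schmidt_on (e : 'I_s -> 'M[C]_k) : psd_schmidt e ->
  forall i j, \tr (e i *m e j) = (i == j)%:R.
Proof.
move=> [[_ he /orthonormal_familyE eon _ _] _].
by apply: eon => i; apply/hermsymmxP; have [] := he i.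
Qed.

Lemma psd_schmidt_unique (e f : 'I_s -> 'M[C]_k) :
  psd_schmidt e -> psd_schmidt f ->
  exists sigma : 'S_s, forall i, e i = f (sigma i).
Proof.
move=> De Df; apply: psd_onb_perm.
- by have [] := De.
- by have [] := Df.
- exact: psd_schmidt_on.
- exact: psd_schmidt_on.
have [He _] := De; apply: (psd_schmidt_coords He).
by have [[_ _ _ _ {1}->] _] := Df; apply: eq_bigr => j _; rewrite scale1r.
Qed.

(** Each [e i] expands in the [gs]. Hence every such decomposition of [D], not only the constructed
    one, has supports that split [A]. *)
Lemma psd_schmidt_top (e : 'I_s -> 'M[C]_k) (i : 'I_s) : psd_schmidt e ->
  top_eigen lam g l (e i).
Proof.
move=> [De pe]; split; first exact: psdmx_herm.
rewrite (psd_schmidt_coords De D_def i) schmidt_op_sum scaler_sumr.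
apply: eq_bigr => j _; rewrite schmidt_opZ.
by have [_ ->] := top_eigen_gs j; rewrite !scalerA mulrC.
Qed.

Lemma psd_schmidt_blocks (e : 'I_s -> 'M[C]_k) : psd_schmidt e ->
  A = \sum_(j < s.+1) compress (image_projs e j) A.
Proof.
move=> De; have [_ pe] := De.
have supp i := herm_proj_support (e i).
have top i := psd_schmidt_top i De.
apply: compress_decomposition => //; first exact: psd_schmidt_on.
- exact: psdmx_herm.
- move=> i; exact: (support_tensl A_def A_psd (top i) (pe i) (supp i)).
- move=> i; exact: (support_tensr A_def A_psd (top i) (pe i) (supp i)).
- move=> i.
  exact: (support_tens_comm lam_gt0 g_herm A_def A_psd (top i) (pe i) (supp i)).
Qed.

End TopBlock.

(* Existence, uniqueness and block decomposition over [R[i]] *)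
Local Close Scope sesquilinear_scope.
Local Open Scope complex_scope.

Theorem theorem2p10 (R : realType) (k n s : nat) (A : 'M[R[i]]_(k * k))
    (lam : 'I_n -> R) (g : 'I_n -> 'M[R[i]]_k)
    (hA : is_SPC A)
    (hdec : hermitian_schmidt A (fun i => (lam i)%:C) g g)
    (hsn : (s <= n)%N)
    (hs0 : (0 < n)%N -> (0 < s)%N)
    (htop : forall i j : 'I_n, (i < s)%N -> (j < s)%N -> lam i = lam j)
    (hgap : forall i j : 'I_n, (i < s)%N -> (s <= j)%N -> lam j < lam i)
    (hdecr : forall i j : 'I_n, (s <= i)%N -> (i <= j)%N -> lam j <= lam i) :
  let D := \sum_(i < n | (i < s)%N) (g i *t g i) in
  let psd_dec (g' : 'I_s -> 'M[R[i]]_k) :=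
    hermitian_schmidt D (fun=> 1) g' g' /\ (forall i, psdmx (g' i)) in
  (exists2 g' : 'I_s -> 'M[R[i]]_k, psd_dec g' &
     forall g'' : 'I_s -> 'M[R[i]]_k, psd_dec g'' ->
       exists sigma : 'S_s, forall i, g'' i = g' (sigma i))
  /\
  (forall g' : 'I_s -> 'M[R[i]]_k, psd_dec g' ->
     let V := image_projs g' in
     [/\ mxdirect (\sum_(i < s) colspace (g' i))%MS,
         A = \sum_(j < s.+1) compress (V j) A
       & forall j : 'I_s.+1, is_SPC (compress (V j) A)]).
Proof.
move=> D psd_dec.
have [l [l_gt0 l_top l_low]] : exists l : R[i], [/\ 0 < l,
    forall i : 'I_n, (i < s)%N -> (lam i)%:C = l
  & forall i : 'I_n, (s <= i)%N -> (lam i)%:C < l].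
  (* For [n = 0] the conditions on coefficients are vacuous and [1] is a positive default; otherwise
     [l] is the first coefficient. *)
  have [n0|n_gt0] := posnP n.
    by exists 1; split=> // i; have := ltn_ord i; rewrite [X in (_ < X)%N]n0.
  have s_gt0 := hs0 n_gt0.
  exists (lam (Ordinal (leq_trans s_gt0 hsn)))%:C; split.
  - by have [lam_gt0 _ _ _ _] := hdec; apply: lam_gt0.
  - by move=> i lt_is; congr (_%:C); apply: htop.
  - by move=> i le_si; rewrite ltcR; apply: hgap.
have [pA _] := hA.
split.
  have [e De] := psd_schmidt_exists pA hdec l_gt0 hsn l_top l_low.
  by exists e => // f Df; apply: psd_schmidt_unique Df De.
move=> e De V; have e_on := psd_schmidt_on De; have [_ pe] := De.
split; first exact: colspace_direct.
  exact: (psd_schmidt_blocks pA hdec hsn l_top De).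
by move=> j; apply: compress_SPC hA; have [] := image_projs_herm_idem e j.
Qed.
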